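(* Let $L$ be a nonempty set equipped with a metric $d_L\colon L\times L\to[0,1]$, let $\mathcal{M}=(S,A,\tau,\rho,\ell)$ be an $L$-labelled continuous-time Markov chain, and let $\lambda\in(0,1)$. Then $\delta_\lambda=\min\{\gamma^{\mathcal{C}}_\lambda : \mathcal{C}\text{ a coupling structure for }\mathcal{M}\}$, where the minimum is taken with respect to the pointwise order on $[0,1]^{S\times S}$ and is attained (i.e. $\delta_\lambda\sqsubseteq\gamma^{\mathcal{C}}_\lambda$ for every coupling structure $\mathcal{C}$, and $\delta_\lambda=\gamma^{\mathcal{C}^*}_\lambda$ for some coupling structure $\mathcal{C}^*$).
   Context: An $L$-labelled CTMC is a tuple $\mathcal{M}=(S,A,\tau,\rho,\ell)$: $S$ nonempty finite set of states, $A\subseteq S$ absorbing states, $\tau\colon S\setminus A\to\mathcal{D}(S)$ transition probability function, $\rho\colon S\setminus A\to\mathbb{R}_{>0}$ exit rates, $\ell\colon S\to L$ labelling. $s\equiv_A t$ means $s,t\in A$ or $s,t\notin A$. $\mathsf{exp}[r]$ is the exponential distribution of rate $r$ on $\mathbb{R}$; $\|\mu-\nu\|_{TV}=\sup_E|\mu(E)-\nu(E)|$ over Borel sets. $\Omega(\mu,\nu)$ is the set of couplings (joint distributions on $S\times S$ with marginals $\mu,\nu$); $\mathcal{K}_d(\mu,\nu)=\min_{\omega\in\Omega(\mu,\nu)}\sum_{u,v}d(u,v)\omega(u,v)$. Let $\alpha(s,t)=\|\mathsf{exp}[\rho(s)]-\mathsf{exp}[\rho(t)]\|_{TV}$, $\beta(s,t)=d_L(\ell(s),\ell(t))$,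 $\mathcal{T}(d)(s,t)=\alpha(s,t)+(1-\alpha(s,t))\mathcal{K}_d(\tau(s),\tau(t))$. The operator $\Delta_\lambda$ on $[0,1]^{S\times S}$ is $\Delta_\lambda(d)(s,t)=1$ if $s\not\equiv_A t$; $\beta(s,t)$ if $s,t\in A$; $\max\{\beta(s,t),\lambda\mathcal{T}(d)(s,t)\}$ if $s,t\notin A$; $\delta_\lambda$ is its least fixed point (pointwise order $\sqsubseteq$). A coupling structure for $\mathcal{M}$ is a function $\mathcal{C}\colon(S\setminus A)\times(S\setminus A)\to\mathcal{D}(S\times S)$ with $\mathcal{C}(s,t)\in\Omega(\tau(s),\tau(t))$ for all $s,t\notin A$. For such $\mathcal{C}$, $\Gamma^{\mathcal{C}}_\lambda$ on $[0,1]^{S\times S}$ is defined like $\Delta_\lambda$ but with $\mathcal{T}$ replaced by $\mathcal{T}^{\mathcal{C}}(d)(s,t)=\alpha(s,t)+(1-\alpha(s,t))\sum_{u,v\in S}d(u,v)\,\mathcal{C}(s,t)(u,v)$; it is monotone and $\gamma^{\mathcal{C}}_\lambda$ (the $\lambda$-discrepancy of $\mathcal{C}$) denotes its least fixed point. *)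

(* Defs.v *)
From HB Require Import structures.
From mathcomp Require Import all_boot all_order all_algebra.
From mathcomp Require Import all_classical all_reals all_analysis.
From mathcomp Require Import lra.

Set Implicit Arguments.
Unset Strict Implicit.
Unset Printing Implicit Defensive.

Import Order.TTheory GRing.Theory Num.Theory.
Import numFieldNormedType.Exports.

Local Open Scope classical_set_scope.
Local Open Scope ring_scope.

Record distr (R : realType) (T : finType) := Distr {
  pmf :> T -> R;
  pmf_ge0 : forall x, 0 <= pmf x;
  pmf_sum1 : \sum_x pmf x = 1 }.

Definition coupling (R : realType) (S : finType) (mu nu : distr R S)
    (omega : distr R (S * S)%type) : Prop :=
  (forall u, \sum_v omega (u, v) = mu u) /\
  (forall v, \sum_u omega (u, v) = nu v).

Definition transport_cost (R : realType) (S : finType) (d : S -> S -> R)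
    (omega : S * S -> R) : R :=
  \sum_u \sum_v d u v * omega (u, v).

(* The infimum is a minimum: see [kantorovich_attained]. *)
Definition kantorovich (R : realType) (S : finType) (d : S -> S -> R)
    (mu nu : distr R S) : R :=
  inf [set transport_cost d omega | omega in coupling mu nu].

Definition tv_dist d (T : measurableType d) (R : realType)
    (mu nu : probability T R) : R :=
  sup [set `|fine (mu E) - fine (nu E)| | E in measurable].

Definition exp_distr (R : realType) (r : R) (r_gt0 : 0 < r) :
    probability (measurableTypeR R) R :=
  exponential_distribution_exponential_prob__canonical__probability_measure_Probability
    r_gt0.

Record ctmc (R : realType) (L : Type) := Ctmc {
  state :> finType;
  state_inhabited : inhabited state;
  absorbing : {set state};
  trans : {s : state | s \notin absorbing} -> distr R state;
  exit_rate : {s : state | s \notin absorbing} -> R;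
  exit_rate_gt0 : forall s, 0 < exit_rate s;
  label : state -> L }.

Definition nonabsorbing (R : realType) (L : Type) (M : ctmc R L) :=
  {s : M | s \notin absorbing M}.

Definition le_fun (R : realType) (S : Type) (d e : S -> S -> R) : Prop :=
  forall s t, d s t <= e s t.

Definition unit_fun (R : realType) (S : Type) (d : S -> S -> R) : Prop :=
  forall s t, 0 <= d s t <= 1.

Definition is_lfp (R : realType) (S : Type)
    (F : (S -> S -> R) -> S -> S -> R) (d : S -> S -> R) : Prop :=
  [/\ unit_fun d, F d = d &
      forall e, unit_fun e -> F e = e -> le_fun d e].

(* Operators on [0,1]^(S x S) are given as total operators on S -> S -> R,
   of which only the restriction to [unit_fun] functions matters.  The default
   value of [xget] is not reached when that restriction is a monotone
   self-map: see [lfpP]. *)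
Definition lfp (R : realType) (S : Type)
    (F : (S -> S -> R) -> S -> S -> R) : S -> S -> R :=
  xget (fun _ _ => 0) [set d | is_lfp F d].

Section Operators.
Context (R : realType) (L : metricType R) (M : ctmc R L).
Implicit Types (d : M -> M -> R) (lambda : R).

Definition alpha (s t : nonabsorbing M) : R :=
  tv_dist (exp_distr (exit_rate_gt0 s)) (exp_distr (exit_rate_gt0 t)).

Definition beta (s t : M) : R := mdist (label s) (label t).

(* [insub s] is [Some s'] with [val s' = s] if s is non-absorbing, and [None]
   if s is absorbing. *)
Definition discrepancy_op lambda (T : nonabsorbing M -> nonabsorbing M -> R)
    (s t : M) : R :=
  match (insub s : option (nonabsorbing M)),
        (insub t : option (nonabsorbing M)) with
  | Some s', Some t' => Num.max (beta s t) (lambda * T s' t')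
  | None, None => beta s t
  | _, _ => 1
  end.

Definition Tau d (s t : nonabsorbing M) : R :=
  alpha s t + (1 - alpha s t) * kantorovich d (trans s) (trans t).

Definition Delta lambda d : M -> M -> R := discrepancy_op lambda (Tau d).

Definition delta lambda : M -> M -> R := lfp (Delta lambda).

Record coupling_structure := CouplingStructure {
  coupling_of :> nonabsorbing M -> nonabsorbing M -> distr R (M * M)%type;
  coupling_ofP : forall s t, coupling (trans s) (trans t) (coupling_of s t) }.

Definition TauC (C : coupling_structure) d (s t : nonabsorbing M) : R :=
  alpha s t + (1 - alpha s t) * transport_cost d (C s t).

Definition Gamma (C : coupling_structure) lambda d : M -> M -> R :=
  discrepancy_op lambda (TauC C d).

Definition gamma (C : coupling_structure) lambda : M -> M -> R :=
  lfp (Gamma C lambda).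

End Operators.
Arguments delta {R L} M lambda.

Section WellDefinedness.
Context (R : realType).

Section Kantorovich.
Context (S : finType).
Implicit Types (d e : S -> S -> R) (mu nu : distr R S).

Lemma product_coupling mu nu : exists omega, coupling mu nu omega.
Proof.
have ge0 (p : S * S) : 0 <= mu p.1 * nu p.2 by rewrite mulr_ge0 ?pmf_ge0.
have sum1 : \sum_p mu p.1 * nu p.2 = 1.
  rewrite -(pair_bigA _ (fun u v => mu u * nu v)) /= -[RHS](pmf_sum1 mu).
  by apply: eq_bigr => u _; rewrite -mulr_sumr pmf_sum1 mulr1.
exists (Distr ge0 sum1); split => [u|v] /=.
  by rewrite -mulr_sumr pmf_sum1 mulr1.
by rewrite -mulr_suml pmf_sum1 mul1r.
Qed.

Lemma transport_cost_le d e (omega : distr R (S * S)%type) :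
  le_fun d e -> transport_cost d omega <= transport_cost e omega.
Proof.
move=> de; apply: ler_sum => u _; apply: ler_sum => v _.
by rewrite ler_wpM2r ?pmf_ge0.
Qed.

Lemma transport_cost_itv d (omega : distr R (S * S)%type) :
  unit_fun d -> 0 <= transport_cost d omega <= 1.
Proof.
move=> d01; apply/andP; split.
  apply: sumr_ge0 => u _; apply: sumr_ge0 => v _.
  by rewrite mulr_ge0 ?pmf_ge0//; case/andP: (d01 u v).
rewrite -(pmf_sum1 omega) (eq_bigr (fun p => omega (p.1, p.2))); last by case.
rewrite -(pair_bigA _ (fun u v => omega (u, v))) /=.
apply: ler_sum => u _; apply: ler_sum => v _.
by rewrite ler_piMl ?pmf_ge0//; case/andP: (d01 u v).
Qed.

Lemma kantorovich_attained d mu nu : exists2 omega, coupling mu nu omega &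
  kantorovich d mu nu = transport_cost d omega /\
  forall omega', coupling mu nu omega' ->
    kantorovich d mu nu <= transport_cost d omega'.
Proof.
pose X := prod_topology (fun _ : S * S => R).
pose row u (f : X) : R := \sum_v f (u, v).
pose col v (f : X) : R := \sum_u f (u, v).
pose P : set X := [set f | forall p : S * S, 0 <= f p <= 1] `&`
  (\bigcap_(u in [set: S]) (row u @^-1` [set mu u]) `&`
   \bigcap_(v in [set: S]) (col v @^-1` [set nu v])).
have addc : continuous (fun x : R * R => x.1 + x.2) by exact: add_continuous.
have projc (p : S * S) : continuous (fun f : X => (f p : R)).
  by move=> f; exact: (@proj_continuous _ (fun _ : S * S => R) p f).
have rowc u : continuous (row u) by apply: continuous_big.
have colc v : continuous (col v) by apply: continuous_big.
have costc : continuous (transport_cost d : X -> R).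
  apply: continuous_big => // u _; apply: continuous_big => // v _ f.
  exact: (@cvgMl_tmp R X (nbhs f) _ (fun g : X => g (u, v)) (d u v) (f (u, v))
    (projc (u, v) f)).
have boxK : compact [set f : X | forall p : S * S, 0 <= f p <= 1].
  rewrite (_ : [set f | _] = [set f | forall p : S * S, `[0, 1]%classic (f p)]).
    exact: (@tychonoff _ (fun _ : S * S => R) (fun _ => `[0, 1]%classic)
      (fun _ => @segment_compact R 0 1)).
  by apply/seteqP; split => f /= f01 p; have := f01 p; rewrite in_itv.
have PK : compact P.
  apply: compact_closedI => //; apply: closedI; apply: closed_bigI => u _.
    by apply: preimage_closed => [f _|]; [exact: rowc|exact: closed_eq].
  by apply: preimage_closed => [f _|]; [exact: colc|exact: closed_eq].
have PE (omega : distr R (S * S)%type) : coupling mu nu omega -> P omega.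
  move=> [omu onu]; split => [p|]; last first.
    by split => u _; [exact: omu|exact: onu].
  rewrite pmf_ge0 /= -(pmf_sum1 omega) (bigD1 p) //= lerDl.
  by apply: sumr_ge0 => *; exact: pmf_ge0.
have [omega0 c0] := product_coupling mu nu.
have [f fP fmin] := @compact_EVT_min X R (transport_cost d) P
  (ex_intro _ _ (PE _ c0)) PK (continuous_subspaceT costc).
move: fP; rewrite inE => -[/= f01 [frow fcol]].
have f0 p : 0 <= f p by case/andP: (f01 p).
have f1 : \sum_p f p = 1.
  rewrite (eq_bigr (fun p => f (p.1, p.2))); last by case.
  rewrite -(pair_bigA _ (fun u v => f (u, v))) /= -(pmf_sum1 mu).
  by apply: eq_bigr => u _; exact: frow.
pose omega := Distr f0 f1.
have comega : coupling mu nu omega.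
  by split => u; [exact: frow|exact: fcol].
have lb : lbound [set transport_cost d w | w in coupling mu nu]
    (transport_cost d omega).
  by move=> _ [w cw <-]; apply: fmin; rewrite inE; exact: PE.
have hlb : has_lbound [set transport_cost d w | w in coupling mu nu].
  by exists (transport_cost d omega).
exists omega => //; split; last by move=> w cw; apply: ge_inf => //; exists w.
apply/eqP; rewrite eq_le; apply/andP; split.
  by apply: ge_inf => //; exists omega.
by apply: lb_le_inf => //; exists (transport_cost d omega), omega.
Qed.

Lemma kantorovich_le d e mu nu :
  le_fun d e -> kantorovich d mu nu <= kantorovich e mu nu.
Proof.
move=> de; have [w cw [-> _]] := kantorovich_attained e mu nu.
have [_ _ [_ /(_ w cw) dw]] := kantorovich_attained d mu nu.
exact: le_trans dw (transport_cost_le w de).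
Qed.

Lemma kantorovich_itv d mu nu : unit_fun d -> 0 <= kantorovich d mu nu <= 1.
Proof.
move=> d01; have [w _ [-> _]] := kantorovich_attained d mu nu.
exact: transport_cost_itv.
Qed.

End Kantorovich.

Lemma tv_dist_itv d (T : measurableType d) (mu nu : probability T R) :
  0 <= tv_dist mu nu <= 1.
Proof.
have p01 (P : probability T R) E : measurable E -> 0 <= fine (P E) <= 1.
  move=> mE; rewrite fine_ge0//= -[1]/(fine 1%:E) fine_le ?fin_num_measure//.
  exact: probability_le1.
have ub : ubound [set `|fine (mu E) - fine (nu E)| | E in measurable] 1.
  move=> _ [E mE <-]; have /andP[m0 m1] := p01 mu E mE.
  have /andP[n0 n1] := p01 nu E mE.
  by rewrite ler_norml; apply/andP; split; lra.
have mem0 : [set `|fine (mu E) - fine (nu E)| | E in measurable] 0.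
  by exists set0; rewrite // !measure0 subrr normr0.
apply/andP; split; first by apply: ub_le_sup => //; exists 1.
by apply: ge_sup => //; exists 0.
Qed.

Lemma lfpP (S : Type) (F : (S -> S -> R) -> S -> S -> R) :
  (forall d, unit_fun d -> unit_fun (F d)) ->
  (forall d e, unit_fun d -> unit_fun e -> le_fun d e -> le_fun (F d) (F e)) ->
  is_lfp F (lfp F).
Proof.
move=> F01 Fmono; rewrite /lfp; apply: (xgetPex _) => /=.
pose pre := [set e : S -> S -> R | unit_fun e /\ le_fun (F e) e].
pose d s t := inf [set e s t | e in pre].
have pre1 : pre (fun _ _ => 1).
  have u1 : @unit_fun R S (fun _ _ => 1) by move=> s t; rewrite ler01 lexx.
  by split => // s t; case/andP: (F01 _ u1 s t).
have lb0 s t : lbound [set e s t | e in pre] 0.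
  by move=> _ [e [e01 _] <-]; case/andP: (e01 s t).
have dle e : pre e -> le_fun d e.
  by move=> pe s t; apply: ge_inf; [exists 0; exact: lb0|exists e].
have led s t x : (forall e, pre e -> x <= e s t) -> x <= d s t.
  move=> xle; apply: lb_le_inf; first by exists 1, (fun _ _ => 1).
  by move=> _ [e pe <-]; exact: xle.
have d01 : unit_fun d.
  move=> s t; rewrite (dle _ pre1) andbT; apply: led => e [e01 _].
  by case/andP: (e01 s t).
have Fd : le_fun (F d) d.
  move=> s t; apply: led => e pe; have [e01 Fe] := pe.
  exact: le_trans (Fmono _ _ d01 e01 (dle _ pe) s t) (Fe s t).
have dF : le_fun d (F d).
  by apply: dle; split; [exact: F01|apply: Fmono => //; exact: F01].
exists d; split => //.
  by apply/funext => s; apply/funext => t; apply/le_anti/andP.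
by move=> e e01 Fe; apply: dle; split=> //; rewrite Fe => s t.
Qed.

Context (L : metricType R) (mdist_le1 : forall x y : L, mdist x y <= 1).
Context (M : ctmc R L) (lambda : R) (lambda01 : 0 <= lambda <= 1).

Lemma alpha_itv (s t : nonabsorbing M) : 0 <= alpha s t <= 1.
Proof. exact: tv_dist_itv. Qed.

Lemma discrepancy_op_itv (T : nonabsorbing M -> nonabsorbing M -> R) :
  unit_fun T -> unit_fun (discrepancy_op lambda T).
Proof.
move=> T01 s t; rewrite /discrepancy_op.
have b01 : 0 <= beta s t <= 1 by rewrite mdist_ge0 mdist_le1.
case: (insub s) => [s'|]; case: (insub t) => [t'|] //; rewrite ?ler01 ?lexx //.
have /andP[b0 b1] := b01; have /andP[l0 l1] := lambda01.
have /andP[T0 T1] := T01 s' t'.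
by rewrite le_max b0 /= ge_max b1 /= mulr_ile1.
Qed.

Lemma discrepancy_op_le (T T' : nonabsorbing M -> nonabsorbing M -> R) :
  le_fun T T' -> le_fun (discrepancy_op lambda T) (discrepancy_op lambda T').
Proof.
move=> TT' s t; rewrite /discrepancy_op.
case: (insub s) => [s'|]; case: (insub t) => [t'|] //.
have /andP[l0 _] := lambda01.
by rewrite ge_max le_max lexx /= le_max (ler_wpM2l l0 (TT' s' t')) orbT.
Qed.

Let mix_itv (a k : R) : 0 <= a <= 1 -> 0 <= k <= 1 -> 0 <= a + (1 - a) * k <= 1.
Proof. by move=> /andP[a0 a1] /andP[k0 k1]; apply/andP; split; nra. Qed.

Let mix_le (a k k' : R) : 0 <= a <= 1 -> k <= k' ->
  a + (1 - a) * k <= a + (1 - a) * k'.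
Proof. by move=> /andP[_ a1] kk'; rewrite lerD2l ler_wpM2l ?subr_ge0. Qed.

Lemma delta_lfp : is_lfp (Delta lambda) (delta M lambda).
Proof.
apply: lfpP => [d d01|d e _ _ de].
  apply: discrepancy_op_itv => s t.
  exact: mix_itv (alpha_itv _ _) (kantorovich_itv _ _ d01).
apply: discrepancy_op_le => s t.
exact: mix_le (alpha_itv _ _) (kantorovich_le _ _ de).
Qed.

Lemma gamma_lfp (C : coupling_structure M) :
  is_lfp (Gamma C lambda) (gamma C lambda).
Proof.
apply: lfpP => [d d01|d e _ _ de].
  apply: discrepancy_op_itv => s t.
  exact: mix_itv (alpha_itv _ _) (transport_cost_itv _ d01).
apply: discrepancy_op_le => s t.
exact: mix_le (alpha_itv _ _) (transport_cost_le _ de).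
Qed.

End WellDefinedness.

(* Main.v *)
(** If [C s t] is an optimal coupling of [trans s] and [trans t] for the cost
    [delta], then [delta] is also a fixed point of [Gamma C], so
    [gamma C <= delta].  Conversely, [Delta d <= Gamma C d] for every [C], so
    [gamma C] is a pre-fixed point of [Delta], and by Knaster-Tarski the least
    fixed point [delta] lies below every pre-fixed point. *)

Require Import Defs.
From mathcomp Require Import all_boot all_order all_algebra.
From mathcomp Require Import all_classical all_reals all_analysis.
From mathcomp Require Import lra.

Import Order.TTheory GRing.Theory Num.Theory.
Import numFieldNormedType.Exports.
Local Open Scope classical_set_scope.
Local Open Scope ring_scope.

Lemma le_fun_anti (R : realType) (S : Type) (d e : S -> S -> R) :
  le_fun d e -> le_fun e d -> d = e.
Proof.
by move=> de ed; apply/funext => s; apply/funext => t; apply/le_anti/andP.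
Qed.

(* [is_lfp] only compares [d] with fixed points.  The operator
   [min (F _) e] has a fixed point, which lies below [e] and is, [e] being
   pre-fixed, a fixed point of [F]. *)
Lemma is_lfp_le_prefixed (R : realType) (S : Type)
    (F : (S -> S -> R) -> S -> S -> R) (d e : S -> S -> R) :
  (forall f, unit_fun f -> unit_fun (F f)) ->
  (forall f g, unit_fun f -> unit_fun g -> le_fun f g -> le_fun (F f) (F g)) ->
  is_lfp F d -> unit_fun e -> le_fun (F e) e -> le_fun d e.
Proof.
move=> F01 Fmono [_ _ dmin] e01 Fee.
pose G (f : S -> S -> R) s t := Num.min (F f s t) (e s t).
have [g01 Gg _] : is_lfp G (lfp G).
  apply: lfpP => [f f01 s t|f g f01 g01 fg s t]; rewrite /G.
    have /andP[F0 F1] := F01 _ f01 s t; have /andP[e0 _] := e01 s t.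
    by rewrite le_min F0 e0 ge_min F1.
  by rewrite le_min !ge_min lexx orbT andbT Fmono.
have ge : le_fun (lfp G) e.
  by move=> s t; rewrite -Gg /G ge_min lexx orbT.
(* Monotonicity gives [F (lfp G) <= F e <= e], so the minimum in [G] is always its first
   argument. *)
have FgE : F (lfp G) = lfp G.
  rewrite -[RHS]Gg; apply/funext => s; apply/funext => t; apply/esym/min_idPl.
  exact: le_trans (Fmono _ _ g01 e01 ge s t) (Fee s t).
by move=> s t; exact: le_trans (dmin _ g01 FgE s t) (ge s t).
Qed.

Section Discrepancy.
Context (R : realType) (L : metricType R).
Context (mdist_le1 : forall x y : L, mdist x y <= 1).
Context (M : ctmc R L) (lambda : R) (lambda01 : 0 <= lambda <= 1).

Lemma Delta_itv (d : M -> M -> R) : unit_fun d -> unit_fun (Delta lambda d).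
Proof.
move=> d01; apply: discrepancy_op_itv => // s t; rewrite /Tau.
have /andP[a0 a1] := alpha_itv s t.
have /andP[k0 k1] := kantorovich_itv (trans s) (trans t) d01.
by apply/andP; split; nra.
Qed.

Lemma Delta_le (d e : M -> M -> R) :
  le_fun d e -> le_fun (Delta lambda d) (Delta lambda e).
Proof.
move=> de; apply: discrepancy_op_le => // s t; rewrite /Tau.
have /andP[_ a1] := alpha_itv s t.
by rewrite lerD2l ler_wpM2l ?subr_ge0 // kantorovich_le.
Qed.

(** [C s t] is one of the couplings over which [kantorovich] minimises, and its weight
    [1 - alpha s t] is nonnegative. *)
Lemma Delta_le_Gamma (C : coupling_structure M) (d : M -> M -> R) :
  le_fun (Delta lambda d) (Gamma C lambda d).
Proof.
apply: discrepancy_op_le => // s t; rewrite /Tau /TauC.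
have /andP[_ a1] := alpha_itv s t.
have [_ _ [_ kmin]] := kantorovich_attained d (trans s) (trans t).
by rewrite lerD2l ler_wpM2l ?subr_ge0 // kmin //; exact: coupling_ofP.
Qed.

Lemma delta_le_gamma (C : coupling_structure M) :
  le_fun (delta M lambda) (gamma C lambda).
Proof.
have [g01 Gg _] := gamma_lfp mdist_le1 lambda01 C.
apply: (is_lfp_le_prefixed _ _ _ _ _ Delta_itv _ _ g01).
- by move=> f g _ _; exact: Delta_le.
- exact: delta_lfp.
(* Unfolding the fixed point on the right only leaves [Delta g <= Gamma C g] at
   [g = gamma C lambda]. *)
- by move=> s t; rewrite -[leRHS](congr1 (fun f => f s t) Gg) Delta_le_Gamma.
Qed.

(** Pick a cost-minimising coupling for each pair of states. Optimality depends on the cost, so [C]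
    is chosen after [d] and the operators are compared at [d] alone. *)
Lemma optimal_coupling_structure (d : M -> M -> R) :
  exists C : coupling_structure M, Gamma C lambda d = Delta lambda d.
Proof.
have /choice[c cP] (p : nonabsorbing M * nonabsorbing M) :
    exists omega, coupling (trans p.1) (trans p.2) omega /\
      kantorovich d (trans p.1) (trans p.2) = transport_cost d omega.
  have [w cw [kw _]] := kantorovich_attained d (trans p.1) (trans p.2).
  by exists w.
exists (CouplingStructure (fun s t => proj1 (cP (s, t)))).
rewrite /Gamma /Delta; congr discrepancy_op.
apply/funext => s; apply/funext => t.
by rewrite /TauC /Tau (proj2 (cP (s, t))).
Qed.

End Discrepancy.

Theorem theorem3p3 (R : realType) (L : metricType R)
    (L_nonempty : [set: L] !=set0)
    (mdist_le1 : forall x y : L, mdist x y <= 1)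
    (M : ctmc R L) (lambda : R)
    (lambda_gt0 : 0 < lambda) (lambda_lt1 : lambda < 1) :
  (forall C : coupling_structure M, le_fun (delta M lambda) (gamma C lambda)) /\
  (exists C : coupling_structure M, delta M lambda = gamma C lambda).
Proof.
have lambda01 : 0 <= lambda <= 1 by rewrite !ltW.
split; first by move=> C; exact: delta_le_gamma.
have [C CE] := optimal_coupling_structure R L M lambda (delta M lambda).
exists C; apply: le_fun_anti; first exact: delta_le_gamma.
have [d01 Dd _] := delta_lfp mdist_le1 M lambda01.
have [_ _ gmin] := gamma_lfp mdist_le1 lambda01 C.
(* [CE] turns the fixed-point equation of [Gamma C] at [delta] into [Dd]. *)
by apply: gmin => //; rewrite CE.
Qed.
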